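(* Let $R=R_0\oplus R_1$ be a $\mathbb{Z}_2$-graded commutative ring and let $Q$ be a $\mathbb{Z}_2$-graded ideal of $R$. Then $Q$ is a $\mathbb{Z}_2$-graded prime ideal of $R$ if and only if one of the following holds: (1) $Q=p+R_1$ where $p$ is a prime ideal of $R_0$ with $R_1^2\subseteq p$; or (2) $Q=(R':_{R_0}R_1)+R'$ where $R'$ is a prime $R_0$-submodule of $R_1$ such that $R_1^3\not\subseteq R'$.
   Context: $\mathbb{Z}_2=\mathbb{Z}/2\mathbb{Z}$. A $\mathbb{Z}_2$-graded commutative ring is a commutative ring $R$ with unit together with additive subgroups $R_0,R_1$ such that $R=R_0\oplus R_1$ and $R_iR_j\subseteq R_{i+j}$ for all $i,j\in\mathbb{Z}_2$ (products of subgroups mean finite sums of products). Then $R_0$ is a subring, $R_1$ is an $R_0$-module, $R_1^2:=R_1R_1$ is an ideal of $R_0$, and $R_1^3:=R_1R_1R_1$ is an $R_0$-submodule of $R_1$. Homogeneous elements are the elements of $R_0\cup R_1$. An ideal $I$ of $R$ is $\mathbb{Z}_2$-graded if $I=(I\cap R_0)\oplus(I\cap R_1)$. A $\mathbb{Z}_2$-graded ideal $P\neq R$ is $\mathbb{Z}_2$-graded prime if whenever $r,s$ are homogeneous elements with $rs\in P$, then $r\in P$ or $s\in P$. For an $R_0$-submodule $R'$ of $R_1$, $(R':_{R_0}R_1)=\{a\in R_0 : aR_1\subseteq R'\}$. A prime submodule $N$ of an $A$-module $M$ is a proper submodule such that for $a\in A$, $m\in M$, $am\in N$ implies $aM\subseteq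 N$ or $m\in N$. *)

(* Defs.v *)
From mathcomp Require Import all_boot all_algebra.
From mathcomp Require Import boolp classical_sets.

Set Implicit Arguments.
Unset Strict Implicit.
Unset Printing Implicit Defensive.

Import GRing.Theory.
Local Open Scope ring_scope.
Local Open Scope classical_set_scope.

(* R is a [comPzRingType], so the zero ring is allowed. The subring R_0 is a
   subset of R rather than a type of its own; the notions of ideal and module
   below are therefore relative to a subset A of scalars, which is used only
   for A = R and A = R_0. *)

Definition add_set (R : comPzRingType) (A B : set R) : set R :=
  [set a + b | a in A & b in B].

(* finite sums of products, not just products *)
Definition mul_set (R : comPzRingType) (A B : set R) : set R :=
  [set x | exists (n : nat) (a b : 'I_n -> R),
     [/\ forall i, A (a i), forall i, B (b i) & x = \sum_(i < n) a i * b i]].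

Definition direct_sum (R : comPzRingType) (C A B : set R) : Prop :=
  C = add_set A B /\ A `&` B = [set 0].

Definition submodule (R : comPzRingType) (A M N : set R) : Prop :=
  [/\ N `<=` M, GRing.zmod_closed [in N]
    & forall a x, A a -> N x -> N (a * x)].

Definition ideal (R : comPzRingType) (A I : set R) : Prop := submodule A A I.

Definition prime_ideal (R : comPzRingType) (A p : set R) : Prop :=
  [/\ ideal A p, p <> A
    & forall a b, A a -> A b -> p (a * b) -> p a \/ p b].

Definition colon (R : comPzRingType) (A N M : set R) : set R :=
  [set a | A a /\ forall x, M x -> N (a * x)].

Definition prime_submodule (R : comPzRingType) (A M N : set R) : Prop :=
  [/\ submodule A M N, N <> M
    & forall a m, A a -> M m -> N (a * m) ->
        (forall x, M x -> N (a * x)) \/ N m].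

Definition Z2_grading (R : comPzRingType) (Rg : 'Z_2 -> set R) : Prop :=
  [/\ forall i, GRing.zmod_closed [in Rg i],
      direct_sum [set: R] (Rg 0) (Rg 1)
    & forall i j, mul_set (Rg i) (Rg j) `<=` Rg (i + j)].

Definition homogeneous (R : comPzRingType) (Rg : 'Z_2 -> set R) : set R :=
  Rg 0 `|` Rg 1.

Definition graded_ideal (R : comPzRingType) (Rg : 'Z_2 -> set R)
    (I : set R) : Prop :=
  ideal [set: R] I /\ direct_sum I (I `&` Rg 0) (I `&` Rg 1).

Definition graded_prime_ideal (R : comPzRingType) (Rg : 'Z_2 -> set R)
    (P : set R) : Prop :=
  [/\ graded_ideal Rg P, P <> [set: R]
    & forall r s, homogeneous Rg r -> homogeneous Rg s ->
        P (r * s) -> P r \/ P s].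

(* Main.v *)
Require Import Defs.
From mathcomp Require Import all_boot all_algebra.
From mathcomp Require Import boolp classical_sets.

(** A graded ideal [Q] is determined by its components [Q0] in [R0] and [Q1]
    in [R1], and the two cases of the theorem are [Q1 = R1] and [Q1 <> R1].

    Suppose that [Q] is graded prime. If [R1] is contained in [Q], then [Q0] is
    a prime of [R0] containing [R1^2]. Otherwise fix [x] in [R1] outside [Q].
    Testing against [x] recovers [Q0] from [Q1]: if [a R1] lies in [Q1] then
    [a x] lies in [Q], hence [a] does, so [Q0 = (Q1 : R1)]. Also [x^3] is not
    in [Q], so that [R1^3] is not contained in [Q1].

    Conversely, in both cases the two summands are recovered from their sum as
    its homogeneous components ([add_set_even], [add_set_odd]), which turns
    primeness of [Q] into a statement on the summands. The only substantial
    point is the product of two odd elements [r], [s] in case (2), which is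
    [prime_submodule_odd]: it is there that [R1^3] enters. *)

Set Implicit Arguments.
Unset Strict Implicit.
Unset Printing Implicit Defensive.

Import GRing.Theory.
Local Open Scope ring_scope.
Local Open Scope classical_set_scope.

Lemma zmod_closed_setP (R : comPzRingType) (N : set R) :
  GRing.zmod_closed [in N] <->
  N 0 /\ (forall x y, N x -> N y -> N (x - y)).
Proof.
split=> -[N0 Nsub]; split.
- exact: set_mem N0.
- by move=> x y Nx Ny; apply/set_mem/Nsub; apply/mem_set.
- exact/mem_set.
- by move=> x y /set_mem Nx /set_mem Ny; apply/mem_set/Nsub.
Qed.

Lemma zmod_closedI (R : comPzRingType) (M N : set R) :
  GRing.zmod_closed [in M] -> GRing.zmod_closed [in N] ->
  GRing.zmod_closed [in M `&` N].
Proof.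
move=> /zmod_closed_setP[M0 Msub] /zmod_closed_setP[N0 Nsub].
apply/zmod_closed_setP; split=> // x y [Mx Nx] [My Ny].
by split; [apply: Msub | apply: Nsub].
Qed.

Lemma mul_set_mul (R : comPzRingType) (A B : set R) a b :
  A a -> B b -> mul_set A B (a * b).
Proof.
by move=> Aa Bb; exists 1%N, (fun=> a), (fun=> b); split=> //; rewrite big_ord1.
Qed.

Lemma mul_set_sub (R : comPzRingType) (A B N : set R) :
  GRing.zmod_closed [in N] ->
  (forall a b, A a -> B b -> N (a * b)) -> mul_set A B `<=` N.
Proof.
move=> /zmod_closed_setP[N0 Nsub] ABN _ [n [a [b [Aa Bb ->]]]].
apply: big_ind => // [x y Nx Ny|i _]; last exact: ABN.
by rewrite -[y]opprK -[- y]sub0r; apply: (Nsub) => //; apply: Nsub.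
Qed.

Lemma colon_zmod (R : comPzRingType) (A N M : set R) :
  GRing.zmod_closed [in A] -> GRing.zmod_closed [in N] ->
  GRing.zmod_closed [in colon A N M].
Proof.
move=> /zmod_closed_setP[A0 Asub] /zmod_closed_setP[N0 Nsub].
apply/zmod_closed_setP; split; first by split=> // x _; rewrite mul0r.
move=> a b [Aa aMN] [Ab bMN]; split=> [|x Mx]; first exact: Asub.
by rewrite mulrBl; apply: Nsub; [apply: aMN | apply: bMN].
Qed.

Section Grading.
Variables (R : comPzRingType) (Rg : 'Z_2 -> set R).
Hypothesis Rgraded : Z2_grading Rg.

Lemma grading_zmod i : GRing.zmod_closed [in Rg i].
Proof. by case: Rgraded. Qed.

Lemma grading_set0 i : Rg i 0.
Proof. by have /zmod_closed_setP[] := grading_zmod i. Qed.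

Lemma grading_setB i x y : Rg i x -> Rg i y -> Rg i (x - y).
Proof. by have /zmod_closed_setP[_] := grading_zmod i; apply. Qed.

Lemma grading_mul i j a b : Rg i a -> Rg j b -> Rg (i + j) (a * b).
Proof. by case: Rgraded => _ _ sub ai bj; apply/sub/mul_set_mul. Qed.

Lemma mul_even_even a b : Rg 0 a -> Rg 0 b -> Rg 0 (a * b).
Proof. by move=> /grading_mul h /h; rewrite addr0. Qed.

Lemma mul_even_odd a b : Rg 0 a -> Rg 1 b -> Rg 1 (a * b).
Proof. by move=> /grading_mul h /h; rewrite add0r. Qed.

Lemma mul_odd_odd a b : Rg 1 a -> Rg 1 b -> Rg 0 (a * b).
Proof.
move=> /grading_mul h /h.
by have -> : 1 + 1 = 0 :> 'Z_2 by apply/val_inj.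
Qed.

Lemma even_odd_eq0 x : Rg 0 x -> Rg 1 x -> x = 0.
Proof.
case: Rgraded => _ [_ R01] _ x0 x1.
by have : (Rg 0 `&` Rg 1) x by []; rewrite R01.
Qed.

(** The difference of [x] and its even summand is both even and odd, hence
    zero, so that nothing is lost by adding up the two summands. *)
Lemma add_set_even (C D : set R) x : C `<=` Rg 0 -> D `<=` Rg 1 ->
  add_set C D x -> Rg 0 x -> C x.
Proof.
move=> CR DR [c Cc [d Dd <-]] cd0.
suff -> : d = 0 by rewrite addr0.
apply: even_odd_eq0; last exact: DR.
by rewrite -[d](addKr c) addrC; apply/grading_setB/CR.
Qed.

Lemma add_set_odd (C D : set R) x : C `<=` Rg 0 -> D `<=` Rg 1 ->
  add_set C D x -> Rg 1 x -> D x.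
Proof.
move=> CR DR [c Cc [d Dd <-]] cd1.
suff -> : c = 0 by rewrite add0r.
apply: even_odd_eq0; first exact: CR.
by rewrite -[c](addrK d); apply/grading_setB/DR.
Qed.

Lemma add_set_graded_prime (p Q : set R) : graded_ideal Rg Q ->
  prime_ideal (Rg 0) p -> Q = add_set p (Rg 1) -> graded_prime_ideal Rg Q.
Proof.
move=> Qgraded [[pR0 /zmod_closed_setP[p0 _] _] pneq pprime] QE.
have Qeven x : Q x -> Rg 0 x -> p x.
  by rewrite QE; apply: add_set_even.
have pQ x : p x -> Q x.
  by move=> px; rewrite QE; exists x => //; exists 0;
    [exact: grading_set0 | rewrite addr0].
have R1Q x : Rg 1 x -> Q x.
  by move=> x1; rewrite QE; exists 0 => //; exists x => //; rewrite add0r.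
split=> // [QT|r s [r0|r1] [s0|s1] Qrs];
  try by [left; apply: R1Q | right; apply: R1Q].
- by apply: pneq; apply/seteqP; split=> // x; apply: Qeven; rewrite QT.
- have [] := pprime r s r0 s0 (Qeven _ Qrs (mul_even_even r0 s0)).
  + by move=> /pQ; left.
  + by move=> /pQ; right.
Qed.

(** If neither [r] nor [s] lies in [R'], primeness can be used twice: for every
    odd [x] the even scalar [r x] multiplies [s] into [R'], hence multiplies
    all of [R1] into [R']; so every even scalar [x y] multiplies [r] into [R'],
    hence again all of [R1], which says that [R1^3] is contained in [R']. *)
Lemma prime_submodule_odd (R' : set R) r s :
  prime_submodule (Rg 0) (Rg 1) R' ->
  ~ (mul_set (mul_set (Rg 1) (Rg 1)) (Rg 1) `<=` R') ->
  Rg 1 r -> Rg 1 s -> colon (Rg 0) R' (Rg 1) (r * s) -> R' r \/ R' s.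
Proof.
move=> [[_ R'zmod _] _ R'prime] cube r1 s1 [_ rsR'].
have [R'r|R'Nr] := pselect (R' r); first by left.
have [R's|R'Ns] := pselect (R' s); first by right.
case: cube; apply: mul_set_sub => // a b.
suff sub : mul_set (Rg 1) (Rg 1) `<=` colon (Rg 0) R' (Rg 1).
  by move=> /sub[_ ]; apply.
apply: mul_set_sub => [|x y x1 y1].
  by apply: colon_zmod => //; apply: grading_zmod.
split; first exact: mul_odd_odd.
have rxR' : forall z, Rg 1 z -> R' (r * x * z).
  have [] // := R'prime (r * x) s (mul_odd_odd r1 x1) s1.
  by rewrite mulrAC; apply: rsR'.
have [] // := R'prime (x * y) r (mul_odd_odd x1 y1) r1.
by rewrite mulrC mulrA; apply: rxR'.
Qed.

Lemma add_set_colon_graded_prime (R' Q : set R) : graded_ideal Rg Q ->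
  prime_submodule (Rg 0) (Rg 1) R' ->
  ~ (mul_set (mul_set (Rg 1) (Rg 1)) (Rg 1) `<=` R') ->
  Q = add_set (colon (Rg 0) R' (Rg 1)) R' -> graded_prime_ideal Rg Q.
Proof.
move=> Qgraded R'P cube QE.
have [[R'R1 R'zmod _] R'neq R'prime] := R'P.
have colonR0 : colon (Rg 0) R' (Rg 1) `<=` Rg 0 by move=> ? [].
have Qeven x : Q x -> Rg 0 x -> colon (Rg 0) R' (Rg 1) x.
  by rewrite QE; apply: add_set_even.
have Qodd x : Q x -> Rg 1 x -> R' x.
  by rewrite QE; apply: add_set_odd.
have /zmod_closed_setP[R'0 _] := R'zmod.
have /zmod_closed_setP[colon0 _] := colon_zmod (Rg 1) (grading_zmod 0) R'zmod.
have colonQ x : colon (Rg 0) R' (Rg 1) x -> Q x.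
  by move=> Cx; rewrite QE; exists x => //; exists 0 => //; rewrite addr0.
have R'Q x : R' x -> Q x.
  by move=> R'x; rewrite QE; exists 0 => //; exists x => //; rewrite add0r.
have even_odd r s : Rg 0 r -> Rg 1 s -> Q (r * s) -> Q r \/ Q s.
  move=> r0 s1 Qrs.
  have [rR'|/R'Q] := R'prime r s r0 s1 (Qodd _ Qrs (mul_even_odd r0 s1)).
    by left; apply: colonQ.
  by right.
split=> // [QT|r s [r0|r1] [s0|s1] Qrs].
- by apply: R'neq; apply/seteqP; split=> // x; apply: Qodd; rewrite QT.
- have [_ rsR'] := Qeven _ Qrs (mul_even_even r0 s0).
  have [sR'|] := pselect (forall x, Rg 1 x -> R' (s * x)).
    by right; apply: colonQ.
  move=> /existsNP[x /not_implyP[x1 R'Nsx]]; left; apply: colonQ; split=> //.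
  have [] // := R'prime r (s * x) r0 (mul_even_odd s0 x1).
  by rewrite mulrA; apply: rsR'.
- exact: even_odd.
- by apply/or_comm/even_odd; rewrite 1?mulrC.
- have rsC := Qeven _ Qrs (mul_odd_odd r1 s1).
  have [] := prime_submodule_odd R'P cube r1 s1 rsC.
  + by move=> /R'Q; left.
  + by move=> /R'Q; right.
Qed.

Lemma graded_prime_odd_sub (Q : set R) :
  graded_prime_ideal Rg Q -> Rg 1 `<=` Q ->
  [/\ prime_ideal (Rg 0) (Q `&` Rg 0),
      mul_set (Rg 1) (Rg 1) `<=` Q `&` Rg 0
    & Q = add_set (Q `&` Rg 0) (Rg 1)].
Proof.
move=> [[[_ Qzmod QM] [QE _]] Qneq Qprime] R1Q.
have Q0zmod := zmod_closedI Qzmod (grading_zmod 0).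
have QE1 : Q = add_set (Q `&` Rg 0) (Rg 1).
  by rewrite {1}QE [Q `&` Rg 1]setIidr.
split=> //.
- split=> [|Q0E|a b a0 b0 [Qab _]].
  + split=> [x []//|//|a x a0 [Qx x0]].
    by split; [apply: QM | apply: mul_even_even].
  + by apply: Qneq; rewrite QE1 Q0E; case: Rgraded => _ [<-].
  + by have [] := Qprime a b (or_introl a0) (or_introl b0) Qab; [left|right].
- apply: mul_set_sub => // a b a1 b1.
  by split; [apply/QM/R1Q | apply: mul_odd_odd].
Qed.

(** An odd element [x] outside [Q] serves as a test element: a product of a
    homogeneous [a] with [x] lies in [Q] only if [a] does. For [a] in the colon
    this identifies the even component of [Q]; for [a = x^2] and [a = x] it
    shows that [x^3] is not in [Q]. *)
Lemma graded_prime_odd_nsub (Q : set R) :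
  graded_prime_ideal Rg Q -> ~ (Rg 1 `<=` Q) ->
  [/\ prime_submodule (Rg 0) (Rg 1) (Q `&` Rg 1),
      ~ (mul_set (mul_set (Rg 1) (Rg 1)) (Rg 1) `<=` Q `&` Rg 1)
    & Q = add_set (colon (Rg 0) (Q `&` Rg 1) (Rg 1)) (Q `&` Rg 1)].
Proof.
move=> [[[_ Qzmod QM] [QE _]] _ Qprime] R1NQ.
have /existsNP[x /not_implyP[x1 QNx]] := R1NQ.
have Q0_colon : colon (Rg 0) (Q `&` Rg 1) (Rg 1) = Q `&` Rg 0.
  apply/seteqP; split=> a [].
    move=> a0 aR1; split=> //.
    by have [] := Qprime a x (or_introl a0) (or_intror x1) (aR1 x x1).1.
  move=> Qa a0; split=> // y y1.
  by split; [rewrite mulrC; apply: QM | apply: mul_even_odd].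
split; last by rewrite Q0_colon.
- split=> [|Q1E|a m a0 m1 [Qam _]].
  + split=> [y []//||a y a0 [Qy y1]].
      exact: zmod_closedI Qzmod (grading_zmod 1).
    by split; [apply: QM | apply: mul_even_odd].
  + by apply: R1NQ => y; rewrite -Q1E => -[].
  + have [Qa|Qm] := Qprime a m (or_introl a0) (or_intror m1) Qam.
      left; suff : colon (Rg 0) (Q `&` Rg 1) (Rg 1) a by case.
      by rewrite Q0_colon.
    by right.
- move=> /(_ (x * x * x))[|Qxxx _].
    by apply/mul_set_mul => //; apply: mul_set_mul.
  have xx0 := mul_odd_odd x1 x1.
  have [Qxx|//] := Qprime _ _ (or_introl xx0) (or_intror x1) Qxxx.
  by have [] := Qprime _ _ (or_intror x1) (or_intror x1) Qxx.
Qed.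

End Grading.

Theorem theorem3p3 (R : comPzRingType) (Rg : 'Z_2 -> set R) (Q : set R)
    (Rgraded : Z2_grading Rg) (Qgraded : graded_ideal Rg Q) :
  graded_prime_ideal Rg Q <->
  (exists p : set R,
     [/\ prime_ideal (Rg 0) p,
         mul_set (Rg 1) (Rg 1) `<=` p
       & Q = add_set p (Rg 1)])
  \/
  (exists R' : set R,
     [/\ prime_submodule (Rg 0) (Rg 1) R',
         ~ (mul_set (mul_set (Rg 1) (Rg 1)) (Rg 1) `<=` R')
       & Q = add_set (colon (Rg 0) R' (Rg 1)) R']).
Proof.
split=> [Qprime|[[p [pprime _ QE]]|[R' [R'prime cube QE]]]].
- have [R1Q|R1NQ] := pselect (Rg 1 `<=` Q).
  + by left; exists (Q `&` Rg 0); apply: graded_prime_odd_sub.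
  + by right; exists (Q `&` Rg 1); apply: graded_prime_odd_nsub.
- exact: add_set_graded_prime Qgraded pprime QE.
- exact: add_set_colon_graded_prime Qgraded R'prime cube QE.
Qed.
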